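(* Let $(X,d)$ be a complete metric space, let $A_1,\dots,A_m$ be nonempty closed subsets of $X$, let $1\le p\le\infty$, and let $T:\bigcup_{i=1}^m A_i\to\bigcup_{i=1}^m A_i$ be a cyclic $p$-$(1-\alpha)$-contraction for some $0<\alpha<1$. If $d_p(A_1,A_2,\dots,A_m)=0$, then $T$ has a unique fixed point $x\in\bigcap_{i=1}^m A_i$.
   Context: Here $m$ is a positive integer, indices of the sets are cyclic ($A_{m+1}=A_1$), and $d(A,B)=\inf\{d(a,b):a\in A,b\in B\}$. For $1\le p<\infty$, $d_p(A_1,\dots,A_m)=\left(\sum_{i=1}^m d(A_i,A_{i+1})^p\right)^{1/p}$, and $d_\infty(A_1,\dots,A_m)=\max_{1\le i\le m} d(A_i,A_{i+1})$. For points $x_1,\dots,x_m,y_1,\dots,y_m\in X$ with $y_{m+1}=y_1$, $d_p(x_1,\dots,x_m;y_1,\dots,y_m)=\left(\sum_{i=1}^m d(x_i,y_{i+1})^p\right)^{1/p}$ for $1\le p<\infty$, and $d_\infty(x_1,\dots,x_m;y_1,\dots,y_m)=\max_{1\le i\le m} d(x_i,y_{i+1})$. For a strictly increasing function $\varphi:[0,\infty)\to[0,\infty)$, a map $T:\bigcup_i A_i\to\bigcup_i A_i$ is a cyclic $p$-$\varphi$-contraction if $T(A_i)\subset A_{i+1}$ for $i=1,\dots,m$ and, for all $x_i,y_i\in A_i$ ($i=1,\dots,m$), $$d_p(Tx_1,\dots,Tx_m;Ty_1,\dots,Ty_m)\le d_p(x_1,\dots,x_m;y_1,\dots,y_m)-\varphi\big(d_p(x_1,\dots,x_m;y_1,\dots,y_m)\big)+\varphi\big(d_p(A_1,\dots,A_m)\big).$$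 For $\beta\in(0,1)$, a cyclic $p$-$\beta$-contraction is a cyclic $p$-$\varphi$-contraction with $\varphi(t)=\beta t$; so a cyclic $p$-$(1-\alpha)$-contraction is the case $\varphi(t)=(1-\alpha)t$. *)

(* Defs.v *)
From HB Require Import structures.
From mathcomp Require Import all_boot all_order all_algebra.
From mathcomp Require Import all_classical all_reals all_analysis.

Set Implicit Arguments.
Unset Strict Implicit.
Unset Printing Implicit Defensive.

Import Order.TTheory GRing.Theory Num.Theory.

Local Open Scope classical_set_scope.
Local Open Scope ring_scope.

#[short(type="completeMetricType")]
HB.structure Definition CompleteMetric (R : realType) :=
  {T of Complete T & Metric R T}.

Section CyclicContraction.
Context {R : realType} {X : metricType R} {m : nat}.
Implicit Types (p : \bar R) (A : 'I_m -> set X) (x y : 'I_m -> X).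

Definition set_dist (A B : set X) : R := inf [set mdist a b | a in A & b in B].

(* The l^p norm of a family of nonnegative reals, 1 <= p <= +oo. As the
   entries are nonnegative, 0 is a harmless neutral element for the maximum.
   The value at -oo is irrelevant. *)
Definition lp_norm p (u : 'I_m -> R) : R :=
  match p with
  | r%:E => (\sum_(i < m) u i `^ r) `^ r^-1
  | +oo%E => \big[Num.max/0]_(i < m) u i
  | -oo%E => 0
  end.

(* [ordS i] is the cyclic successor of i in 'I_m: it sends m.-1 to 0. *)
Definition dist_sets p A : R :=
  lp_norm p (fun i => set_dist (A i) (A (ordS i))).

Definition dist_points p x y : R :=
  lp_norm p (fun i => mdist (x i) (y (ordS i))).

(* phi represents a map [0, +oo[ -> [0, +oo[; its values at negative reals
   are never used. *)
Definition cyclic_phi_contraction p (phi : R -> R) A (T : X -> X) : Prop :=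
  [/\ (forall t, 0 <= t -> 0 <= phi t),
      (forall s t, 0 <= s -> s < t -> phi s < phi t),
      (forall i, T @` A i `<=` A (ordS i)) &
      forall x y, (forall i, A i (x i)) -> (forall i, A i (y i)) ->
        dist_points p (T \o x) (T \o y) <=
        dist_points p x y - phi (dist_points p x y) + phi (dist_sets p A)].

Definition cyclic_beta_contraction p (beta : R) A (T : X -> X) : Prop :=
  0 < beta < 1 /\ cyclic_phi_contraction p (fun t => beta * t) A T.

End CyclicContraction.

(* Main.v *)
Require Import Defs.
From mathcomp Require Import all_boot all_order all_algebra.
From mathcomp Require Import all_classical all_reals all_analysis.
From mathcomp Require Import ring lra.

Set Implicit Arguments.
Unset Strict Implicit.
Unset Printing Implicit Defensive.

Import Order.TTheory GRing.Theory Num.Theory.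
Import numFieldNormedType.Exports.

Local Open Scope classical_set_scope.
Local Open Scope ring_scope.

(** As [dist_sets p A = 0], the contraction condition reads
[dist_points p (T \o x) (T \o y) <= alpha * dist_points p x y]; since [lp_norm]
is invariant under reindexing, it iterates. Applied to [x] and
[y (ordS i) = T (x i)], it makes the orbit of a point of [A i] Cauchy; its limit
[l] lies in every [A i], because the orbit visits each of them infinitely often.
Comparing the constant family [l] with families of late points of the orbit
gives [T l = l], and comparing two constant families gives uniqueness. *)

(** * The l^p norm of a finite family: reindexing and comparison with the entries *)

Section LpNorm.
Context {R : realType} {m : nat}.
Implicit Types (p : \bar R) (u : 'I_m -> R).

Lemma lp_norm_bij p u (s : 'I_m -> 'I_m) :
  bijective s -> lp_norm p (u \o s) = lp_norm p u.
Proof.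
move=> bs; case: p => [r| |] //=.
  by rewrite [in RHS](reindex s) //=; exact: onW_bij.
by rewrite [in RHS](reindex s) //=; exact: onW_bij.
Qed.

Lemma le_lp_norm p u i :
  (1 <= p)%E -> (forall j, 0 <= u j) -> u i <= lp_norm p u.
Proof.
case: p => [r| |] //= p1 u0; last exact: le_bigmax.
have r1 : 1 <= r by rewrite lee_fin in p1.
have r0 : 0 < r by rewrite (lt_le_trans ltr01).
have ui : u i = (u i `^ r) `^ r^-1.
  by rewrite -powRrM divff ?gt_eqF// powRr1.
rewrite [leLHS]ui ge0_ler_powR ?nnegrE ?invr_ge0 ?powR_ge0 ?(ltW r0)//.
  by rewrite sumr_ge0// => j _; exact: powR_ge0.
by rewrite (bigD1 i)//= lerDl sumr_ge0// => j _; exact: powR_ge0.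
Qed.

(** The sharp constant is m^(1/p); the cruder m serves every p at once, since m <= m^r for m, r >=
    1. *)
Lemma lp_norm_le p u (c : R) : (1 <= p)%E -> (0 < m)%N ->
  (forall j, 0 <= u j <= c) -> lp_norm p u <= m%:R * c.
Proof.
move=> + m0 uc; have m1 : 1 <= m%:R :> R by rewrite ler1n.
have c0 : 0 <= c by have /andP[/le_trans] := uc (Ordinal m0); apply.
case: p => [r| |] //= p1; last first.
  rewrite bigmax_le ?mulr_ge0// => j _; have /andP[_ /le_trans] := uc j; apply.
  by rewrite ler_peMl.
have r1 : 1 <= r by rewrite lee_fin in p1.
have r0 : 0 < r by rewrite (lt_le_trans ltr01).
have mc0 : 0 <= m%:R * c by rewrite mulr_ge0.
have -> : m%:R * c = ((m%:R * c) `^ r) `^ r^-1.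
  by rewrite -powRrM divff ?gt_eqF// powRr1.
rewrite ge0_ler_powR ?nnegrE ?invr_ge0 ?powR_ge0 ?(ltW r0)//.
  by rewrite sumr_ge0// => j _; exact: powR_ge0.
rewrite powRM//; apply: (@le_trans _ _ (m%:R * c `^ r)).
  rewrite mulr_natl -[X in _ *+ X](card_ord m) -sumr_const ler_sum// => j _.
  have /andP[u0 uj] := uc j.
  by rewrite ge0_ler_powR ?nnegrE// ltW.
by rewrite ler_wpM2r ?powR_ge0// le1r_powR.
Qed.

End LpNorm.

(** * Consequences of geometric decay *)

Lemma le0_geometric (R : realType) (a C t : R) : 0 <= a < 1 ->
  (forall n, t <= C * a ^+ n) -> t <= 0.
Proof.
move=> /andP[a0 a1] tC.
have aC : geometric C a @ \oo --> (0 : R).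
  by apply: cvg_geometric; rewrite ger0_norm.
by rewrite -(cvg_lim (@Rhausdorff R) aC) limr_ge//; [exact: cvgP aC|exact: nearW].
Qed.

Lemma cvg_geometric_dist (R : realType) (X : completeMetricType R)
    (u : nat -> X) (a C : R) : 0 <= a < 1 ->
  (forall n, mdist (u n) (u n.+1) <= C * a ^+ n) -> cvg (u @ \oo).
Proof.
move=> /andP[a0 a1] uC; apply/cauchy_cvgP/cauchy_exP => e e0.
(* Telescoping against a partial geometric sum, multiplied through by 1 - a. Keeping the factor 1 -
   a^k closes the induction: 1 - a^k + (1 - a) a^k = 1 - a^(k+1). *)
have dist_le n k : (1 - a) * mdist (u n) (u (n + k)%N) <= C * a ^+ n * (1 - a ^+ k).
  elim: k => [|k ih]; first by rewrite addn0 mdistxx expr0 subrr !mulr0.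
  have tri := metric_triangle (u n) (u (n + k)%N) (u (n + k).+1%N).
  have stp := uC (n + k)%N; rewrite exprD in stp.
  rewrite addnS exprS.
  have a'0 : 0 <= 1 - a by rewrite subr_ge0 ltW.
  apply: le_trans (ler_wpM2l a'0 (le_trans tri (lerD (lexx _) stp))) _.
  rewrite mulrDr (le_trans (lerD ih (lexx _)))// le_eqVlt; apply/orP; left.
  by apply/eqP; ring.
have C0 : 0 <= C.
  by have := uC 0%N; rewrite expr0 mulr1; apply: le_trans; exact: mdist_ge0.
have : geometric C a @ \oo --> (0 : R).
  by apply: cvg_geometric; rewrite ger0_norm.
move=> /cvgrPdist_lt/(_ ((1 - a) * e)).
rewrite mulr_gt0 ?subr_gt0// => /(_ isT)[N _ /(_ N (leqnn N))] /=.
rewrite sub0r normrN ger0_norm ?mulr_ge0 ?exprn_ge0// => CN.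
exists (u N), N => // n /= Nn; rewrite ballEmdist /= -(subnKC Nn).
rewrite -(ltr_pM2l (_ : 0 < 1 - a)) ?subr_gt0//.
apply: le_lt_trans CN; apply: le_trans (dist_le _ _) _.
by rewrite ler_piMr ?mulr_ge0 ?exprn_ge0// lerBlDr lerDl exprn_ge0.
Qed.

(** * Iterating the cyclic successor *)

Lemma val_iter_ordS m (i : 'I_m) n :
  iter n (@ordS m) i = ((i + n) %% m)%N :> nat.
Proof.
elim: n => [|n ih] /=; first by rewrite addn0 modn_small.
by rewrite ih addnS -addn1 modnDml addn1.
Qed.

Lemma iter_ordS_visits m (i j : 'I_m) N :
  exists2 n, (N <= n)%N & iter n (@ordS m) i = j.
Proof.
(* From i, m - i steps lead to 0 and j more to j; the N full turns added to them make n at least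
   N. *)
exists (N * m + (j + (m - i)))%N.
  by rewrite (leq_trans (leq_pmulr N (leq_trans (ltn0Sn i) (ltn_ord i))))// leq_addr.
apply: val_inj; rewrite /= val_iter_ordS addnCA modnMDl addnCA subnKC 1?ltnW//.
by rewrite modnDr modn_small.
Qed.

(** * Orbits and fixed points of a cyclic contraction *)

Section Cyclic.
Context {R : realType} {X : completeMetricType R} {m : nat}.
Variables (A : 'I_m -> set X) (T : X -> X).
Hypothesis TA : forall i, T @` A i `<=` A (ordS i).

Lemma iter_cyclic n i x : A i x -> A (iter n (@ordS m) i) (iter n T x).
Proof. by move=> Aix; elim: n => //= n ih; apply: TA; exists (iter n T x). Qed.

(** A fixed point equals all its iterates, and these run through every [A j]. Uniqueness over the
    union thus reduces to the intersection. *)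
Lemma fixed_in_bigcap y : (\bigcup_i A i) y -> T y = y -> (\bigcap_i A i) y.
Proof.
move=> [i _ Aiy] Ty j _; have [n _ <-] := iter_ordS_visits i j 0%N.
by rewrite -(iter_fix n Ty); exact: iter_cyclic.
Qed.

Lemma orbit_cvg_bigcap i x l : A i x -> (forall i, closed (A i)) ->
  iter n T x @[n --> \oo] --> l -> (\bigcap_i A i) l.
Proof.
move=> Aix Ac xl j _; apply: Ac => B /xl[N _ NB].
have [n Nn nj] := iter_ordS_visits i j N.
by exists (iter n T x); split; [rewrite -nj; exact: iter_cyclic|exact: NB].
Qed.

Context {p : \bar R} {alpha : R}.
Hypotheses (p1 : (1 <= p)%E) (m0 : (0 < m)%N) (alpha01 : 0 <= alpha < 1).
Hypothesis T_contr : forall x y, (forall i, A i (x i)) -> (forall i, A i (y i)) ->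
  dist_points p (T \o x) (T \o y) <= alpha * dist_points p x y.

Lemma mdist_le_dist_points (x y : 'I_m -> X) i :
  mdist (x i) (y (ordS i)) <= dist_points p x y.
Proof.
by apply: (@le_lp_norm _ _ p (fun j => mdist (x j) (y (ordS j)))) => // j;
  exact: mdist_ge0.
Qed.

(* [T \o x] is not a selection of [A], but [T \o x \o ord_pred] is. *)
Lemma dist_points_iter n x y : (forall i, A i (x i)) -> (forall i, A i (y i)) ->
  dist_points p (iter n T \o x) (iter n T \o y) <= alpha ^+ n * dist_points p x y.
Proof.
elim: n x y => [|n ih] x y Ax Ay; first by rewrite expr0 mul1r.
have TAp z : (forall i, A i (z i)) -> forall i, A i (T (z (ord_pred i))).
  by move=> Az i; rewrite -[X in A X]ord_predK; apply: TA; exists (z (ord_pred i)).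
(* Shifting both families by the same index only permutes the pairs at positions i and i+1, hence
   the entries of the norm. *)
have shift (f : X -> X) (z w : 'I_m -> X) : dist_points p (f \o z) (f \o w) =
    dist_points p (f \o (z \o @ord_pred m)) (f \o (w \o @ord_pred m)).
  rewrite /dist_points -[RHS](lp_norm_bij _ _ (@ordS_bij m)).
  by congr (lp_norm p _); apply/funext => i /=; rewrite !ordSK.
have iT (z : 'I_m -> X) : iter n.+1 T \o z = iter n T \o (T \o z).
  by apply/funext => i /=; rewrite -iterSr.
rewrite !iT shift (le_trans (ih _ _ (TAp x Ax) (TAp y Ay)))//.
have := shift T x y => /= <-.
rewrite exprSr -mulrA ler_wpM2l ?T_contr// exprn_ge0//.
by case/andP: alpha01.
Qed.

Lemma orbit_cvg x : (forall i, A i (x i)) ->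
  forall i, cvg (iter n T (x i) @[n --> \oo]).
Proof.
move=> Ax i; pose y j := T (x (ord_pred j)).
have Ay j : A j (y j).
  by rewrite -[X in A X]ord_predK; apply: TA; exists (x (ord_pred j)).
apply: (@cvg_geometric_dist _ _ _ alpha (dist_points p x y)) => // n.
have := mdist_le_dist_points (iter n T \o x) (iter n T \o y) i.
rewrite /= /y ordSK -iterSr mulrC => /le_trans; apply.
exact: dist_points_iter.
Qed.

(** The contraction condition bounds whole families and not one distance, so the constant family [l]
    is compared with a selection close to [l] in every [A j] at once. *)
Lemma orbit_cvg_fixed i x l : A i x -> (\bigcap_i A i) l ->
  iter n T x @[n --> \oo] --> l -> T l = l.
Proof.
move=> Aix Al xl; apply/mdist_positivity/eqP.
rewrite eq_le mdist_ge0 andbT; apply/ler_addgt0Pr => /= e e0; rewrite add0r.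
(* The final estimate is m d from the norm bound plus d from the triangle inequality. *)
pose d := e / (m%:R + 1).
have m10 : 0 < m%:R + 1 :> R by rewrite ltr_wpDl.
have d0 : 0 < d by rewrite divr_gt0.
have [N _ Nd] := metricType_numDomainType.cvgr_dist_le xl d0.
(* Closeness of y serves inside the norm, that of [T y] in the triangle inequality; [T y] is the
   next orbit point, so one N gives both. *)
have near_l j : exists2 y, A j y & mdist l y <= d /\ mdist l (T y) <= d.
  have [n Nn nj] := iter_ordS_visits i j N.
  exists (iter n T x); first by rewrite -nj; exact: iter_cyclic.
  by split; [exact: Nd|rewrite -iterS; apply: Nd; exact: leqW].
have /choice[y yP] : forall j, exists y, [/\ A j y, mdist l y <= d & mdist l (T y) <= d].
  by move=> j; have [y ? []] := near_l j; exists y.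
have Ay j : A j (y j) by case: (yP j).
have := mdist_le_dist_points (T \o fun=> l) (T \o y) i.
move=> /le_trans /(_ (T_contr (fun j => Al j I) Ay)) /= Tl.
have {}Tl : mdist (T l) (T (y (ordS i))) <= m%:R * d.
  apply: (le_trans Tl); apply: (@le_trans _ _ (dist_points p (fun=> l) y)).
    rewrite ler_piMl//; last by case/andP: alpha01 => _ /ltW.
    exact: le_trans (mdist_ge0 _ _) (mdist_le_dist_points _ _ i).
  by apply: lp_norm_le => // j; rewrite mdist_ge0/=; case: (yP (ordS j)).
apply: le_trans (metric_triangle _ (T (y (ordS i))) _) _.
have -> : e = m%:R * d + d by rewrite /d; field; rewrite gt_eqF.
by rewrite lerD// metric_sym; case: (yP (ordS i)).
Qed.

(** Iteration leaves both constant families unchanged, so the distance is at most D alpha^n for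
    every n, with D their [dist_points]. *)
Lemma fixed_unique x y : (\bigcap_i A i) x -> (\bigcap_i A i) y ->
  T x = x -> T y = y -> y = x.
Proof.
move=> Ax Ay Tx Ty; apply/esym/mdist_positivity/eqP.
rewrite eq_le mdist_ge0 andbT.
apply: (@le0_geometric _ alpha (dist_points p (fun=> x) (fun=> y))) => // n.
have := mdist_le_dist_points (iter n T \o fun=> x) (iter n T \o fun=> y)
  (Ordinal m0).
rewrite /= !iter_fix// mulrC => /le_trans; apply.
by apply: (@dist_points_iter n (fun=> x) (fun=> y)) => i; [exact: Ax|exact: Ay].
Qed.

End Cyclic.

Theorem theorem2p9 (R : realType) (X : completeMetricType R) (m : nat)
    (m_gt0 : (0 < m)%N) (A : 'I_m -> set X)
    (A_neq0 : forall i, A i !=set0) (A_closed : forall i, closed (A i))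
    (p : \bar R) (p_ge1 : (1 <= p)%E)
    (T : {fun \bigcup_i A i >-> \bigcup_i A i})
    (alpha : R) (alpha01 : 0 < alpha < 1)
    (T_contr : cyclic_beta_contraction p (1 - alpha) A T)
    (dA0 : dist_sets p A = 0) :
  exists x : X, [/\ (\bigcap_i A i) x, T x = x &
    forall y : X, (\bigcup_i A i) y -> T y = y -> y = x].
Proof.
have a01 : 0 <= alpha < 1 by case/andP: alpha01 => /ltW -> ->.
case: T_contr => _ [_ _ TA contr].
(* With phi(t) = (1 - alpha) t, the bound D - phi(D) + phi(0) is alpha D. *)
have T_contr x y : (forall i, A i (x i)) -> (forall i, A i (y i)) ->
    dist_points p (T \o x) (T \o y) <= alpha * dist_points p x y.
  by move=> Ax Ay; have := contr _ _ Ax Ay; rewrite dA0; lra.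
have /choice[x Ax] : forall i, exists x, A i x by move=> i; exact: A_neq0.
pose i0 := Ordinal m_gt0.
(* Only the orbit starting in [A i0] is followed; the other chosen points complete the selection
   that the contraction condition requires. *)
have /cvg_ex[l xl] : cvg (iter n T (x i0) @[n --> \oo]).
  exact: orbit_cvg a01 T_contr _ Ax _.
have Al := orbit_cvg_bigcap TA (Ax i0) A_closed xl.
have Tl := orbit_cvg_fixed TA p_ge1 m_gt0 a01 T_contr (Ax i0) Al xl.
exists l; split=> // y Ay Ty.
have Ay' := fixed_in_bigcap TA Ay Ty.
exact: (fixed_unique TA p_ge1 m_gt0 a01 T_contr Al Ay' Tl Ty).
Qed.
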